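(* Let $S$ be a semigroup and $(A,\cdot)$ a firm and strong right partial $S$-act. Then: (1) The global $S$-act $(A\otimes S,* )$, where $(a\otimes s)*t=a\otimes st$, is an $A$-generated globalization of $(A,\cdot)$ via the map $\delta\colon A\to A\otimes S$ given by $\delta(a)=b\otimes t$ whenever $a=b\cdot t$ with $b\in A$, $t\in S$. (2) If a global $S$-act $(B,\circ)$ is a globalization of $(A,\cdot)$ via a map $\iota\colon A\to B$, then there is a unique morphism of right global $S$-acts $\varphi\colon A\otimes S\to B$ such that $\iota=\varphi\delta$.
   Context: A partial map $f\colon X\to Y$ is a map $Z\to Y$ with $Z\subseteq X$; $f(x)$ is defined iff $x\in Z$. Let $S$ be a semigroup. All actions are right actions. A global action of $S$ on a set $B$ is a map $*\colon B\times S\to B$ with $(b*s)*t=b*(st)$; then $(B,* )$ is a global $S$-act. A partial action of $S$ on a set $A$ is a partial map $\cdot\colon A\times S\to A$ such that (PA): if $a\cdot s$ and $(a\cdot s)\cdot t$ are defined, then $a\cdot st$ is defined and $(a\cdot s)\cdot t=a\cdot st$; then $(A,\cdot)$ is a partial $S$-act. It is strong if whenever $a\cdot s$ and $a\cdot st$ are defined, $(a\cdot s)\cdot t$ is defined and $(a\cdot s)\cdot t=a\cdot st$. It is unitary if for each $a\in A$ there are $b\in A$, $s\in S$ such that $b\cdot s$ is defined and $a=b\cdot s$. Tensor product: for $(a,s),(b,t)\in A\times S$ write $(a,s)\to(b,t)$ if there is $u\in S$ such that $s=ut$ and $a\cdot u$ is defined and equals $b$. Let $\rho$ be the smallest equivalence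 relation on $A\times S$ containing $\to$; $A\otimes S=(A\times S)/\rho$, and $a\otimes s$ is the $\rho$-class of $(a,s)$. The rule $(a\otimes s)*t=a\otimes st$ is a well-defined global action of $S$ on $A\otimes S$. The partial action $\cdot$ is firm if it is unitary and, whenever $a\cdot s$ and $b\cdot t$ are defined and $a\cdot s=b\cdot t$, one has $a\otimes s=b\otimes t$ in $A\otimes S$. In particular, if $\cdot$ is firm then $\delta$ is well defined. A globalization of $(A,\cdot)$ is a global $S$-act $(B,* )$ together with an injective map $\iota\colon A\to B$ such that for all $a\in A,s\in S$: (G1) $a\cdot s$ is defined iff $\iota(a)*s\in\iota(A)$; (G2) if $a\cdot s$ is defined then $\iota(a\cdot s)=\iota(a)*s$. One says $(B,* )$ is a globalization of $(A,\cdot)$ via $\iota$. It is $A$-generated if every $b\in B$ equals $\iota(a)*s$ for some $a\in A$, $s\in S$. A morphism of global $S$-acts $(B,* )\to(C,\circ)$ is a map $\varphi$ with $\varphi(b*s)=\varphi(b)\circ s$ for all $b\in B$, $s\in S$. *)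

(* Defs.v *)
From Stdlib Require Import Relation_Operators.
From mathcomp Require Import all_boot generic_quotient.
From mathcomp Require Import boolp.

Set Implicit Arguments.
Unset Strict Implicit.
Unset Printing Implicit Defensive.

Local Open Scope quotient_scope.
Local Open Scope group_scope.

(* [pact a s = Some b] means that a.s is defined and equal to b, and
   [pact a s = None] that a.s is undefined. *)
Record partialAct (S : semigroupType) (A : Type) := PartialAct {
  pact :> A -> S -> option A;
  pactM : forall (a b c : A) (s t : S),
    pact a s = Some b -> pact b t = Some c -> pact a (s * t) = Some c
}.

Record globalAct (S : semigroupType) (B : Type) := GlobalAct {
  gact :> B -> S -> B;
  gactM : forall (b : B) (s t : S), gact (gact b s) t = gact b (s * t)
}.

Definition gact_morphism (S : semigroupType) (B C : Type)
    (actB : globalAct S B) (actC : globalAct S C) (phi : B -> C) : Prop :=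
  forall (b : B) (s : S), phi (actB b s) = actC (phi b) s.

Section PartialActs.
Variables (S : semigroupType) (A : Type) (act : partialAct S A).

Definition pact_defined (a : A) (s : S) : Prop := exists b, act a s = Some b.

Definition strong : Prop :=
  forall (a b c : A) (s t : S),
    act a s = Some b -> act a (s * t) = Some c -> act b t = Some c.

Definition unitary : Prop :=
  forall a : A, exists (b : A) (s : S), act b s = Some a.

Definition tensor_step (x y : A * S) : Prop :=
  exists u : S, x.2 = u * y.2 /\ act x.1 u = Some y.1.

Definition tensor_rel : A * S -> A * S -> Prop :=
  clos_refl_sym_trans (A * S) tensor_step.

(* [{classic _}] supplies the choiceType structure (and [`[< _ >]] the boolean
   relation) that [{eq_quot _}] requires. *)
Definition tensor_relb : rel {classic A * S} :=
  fun x y => `[< tensor_rel x y >].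

Lemma tensor_relb_refl : reflexive tensor_relb.
Proof. by move=> x; apply/asboolP; exact: rst_refl. Qed.

Lemma tensor_relb_sym : symmetric tensor_relb.
Proof. by move=> x y; apply/asboolP/asboolP; exact: rst_sym. Qed.

Lemma tensor_relb_trans : transitive tensor_relb.
Proof.
by move=> y x z /asboolP xy /asboolP yz; apply/asboolP; exact: rst_trans xy yz.
Qed.

Canonical tensor_equiv :=
  EquivRel tensor_relb tensor_relb_refl tensor_relb_sym tensor_relb_trans.

Definition tensor : Type := {eq_quot tensor_equiv}.

Definition tens (a : A) (s : S) : tensor :=
  (\pi_({eq_quot tensor_equiv}) ((a, s) : {classic A * S})).

Lemma tens_eq (x y : A * S) :
  tens x.1 x.2 = tens y.1 y.2 <-> tensor_rel x y.
Proof.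
case: x y => [a s] [b t]; rewrite /tens /=.
by split=> [/eqmodP/asboolP | abst] //; apply/eqmodP/asboolP.
Qed.

(* This uses a chosen representative of the class; [tensor_opE] shows that the
   result does not depend on it. *)
Definition tensor_op (x : tensor) (t : S) : tensor :=
  let r : A * S := repr (x : {eq_quot tensor_equiv}) in tens r.1 (r.2 * t).

Lemma tensor_relM (x y : A * S) (t : S) :
  tensor_rel x y -> tensor_rel (x.1, x.2 * t) (y.1, y.2 * t).
Proof.
elim=> {x y} [x y [u [xy au]] | x | x y _ | x y z _ + _].
- by apply: rst_step; exists u; split; rewrite //= xy mulgA.
- exact: rst_refl.
- exact: rst_sym.
- exact: rst_trans.
Qed.

Lemma tensor_opE (a : A) (s t : S) :
  tensor_op (tens a s) t = tens a (s * t).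
Proof.
rewrite /tensor_op; set r : A * S := repr _.
apply/(tens_eq (r.1, r.2 * t) (a, s * t)).
apply: (@tensor_relM r (a, s)); apply/tens_eq.
by rewrite /tens -surjective_pairing /r reprK.
Qed.

Lemma tensor_opM (x : tensor) (s t : S) :
  tensor_op (tensor_op x s) t = tensor_op x (s * t).
Proof. by rewrite [tensor_op x s]/tensor_op tensor_opE -mulgA. Qed.

Definition tensor_act : globalAct S tensor := GlobalAct tensor_opM.

Definition firm : Prop :=
  unitary /\
  forall (a b c : A) (s t : S),
    act a s = Some c -> act b t = Some c -> tens a s = tens b t.

Definition is_delta (delta : A -> tensor) : Prop :=
  forall (a b : A) (t : S), act b t = Some a -> delta a = tens b t.

Definition globalization (B : Type) (actB : globalAct S B) (iota : A -> B) :
    Prop :=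
  [/\ injective iota,
      forall (a : A) (s : S),
        pact_defined a s <-> (exists c : A, actB (iota a) s = iota c)
    & forall (a b : A) (s : S),
        act a s = Some b -> iota b = actB (iota a) s].

Definition generated (B : Type) (actB : globalAct S B) (iota : A -> B) : Prop :=
  forall b : B, exists (a : A) (s : S), b = actB (iota a) s.

End PartialActs.

(* Main.v *)
(** Strongness and (PA) together say that a step [(a, ut) -> (a.u, t)] neither
    creates nor destroys definedness, so the partial element [a.s] is an
    invariant of the tensor [a (x) s].  Injectivity of delta and (G1) follow
    from it.  A tensor [a (x) s] equals [delta a * s], which forces the morphism
    in (2) to be [a (x) s |-> iota a * s]. *)
From Stdlib Require Import Relation_Operators.
From mathcomp Require Import generic_quotient boolp.
Require Import Defs.
From mathcomp Require Import all_boot.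

Set Implicit Arguments.
Unset Strict Implicit.
Unset Printing Implicit Defensive.

Local Open Scope quotient_scope.
Local Open Scope group_scope.

Section Tensor.
Variables (S : semigroupType) (A : Type) (act : partialAct S A).

Lemma tensor_surj (x : tensor act) : exists a s, x = tens act a s.
Proof.
pose r : A * S := repr (x : {eq_quot tensor_equiv act}).
by exists r.1, r.2; rewrite /tens -surjective_pairing /r reprK.
Qed.

(** Having equal values under [f] is an equivalence relation, so it contains [tensor_rel] once it
    contains the generating steps. *)
Lemma tensor_rel_invariant (B : Type) (f : A -> S -> B) :
  (forall a b u t, act a u = Some b -> f a (u * t) = f b t) ->
  forall a b s t, tens act a s = tens act b t -> f a s = f b t.
Proof.
move=> fP a b s t /(tens_eq act (a, s) (b, t)).
suff H x y : tensor_rel act x y -> f x.1 x.2 = f y.1 y.2 by exact: H.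
elim=> {x y} [x y [u [-> xu]] | // | x y _ -> // | x y z _ -> _ -> //].
exact: fP.
Qed.

Lemma tensor_lift (B : Type) (f : A -> S -> B) :
  (forall a b u t, act a u = Some b -> f a (u * t) = f b t) ->
  exists phi : tensor act -> B, forall a s, phi (tens act a s) = f a s.
Proof.
move=> fP.
(* The value at [x] is specified over all its representations at once, so no representative has to
   be fixed. *)
have /choice[phi phiP] (x : tensor act) :
    exists y, forall a s, x = tens act a s -> y = f a s.
  have [a [s ->]] := tensor_surj x.
  by exists (f a s) => b t; exact: tensor_rel_invariant fP _ _ _ _.
by exists phi => a s; exact: phiP.
Qed.

Lemma tens_act a b u t : act a u = Some b -> tens act a (u * t) = tens act b t.
Proof.
move=> au; apply/(tens_eq act (a, u * t) (b, t)).
by apply: rst_step; exists u.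
Qed.

Lemma strong_tens_eq : strong act ->
  forall a b s t, tens act a s = tens act b t -> act a s = act b t.
Proof.
move=> str; apply: tensor_rel_invariant => a b u t au.
case bt: (act b t) => [c|]; first exact: pactM au bt.
(* Here [b.t] is undefined; if [a.(ut)] were defined, strongness would define [b.t]. *)
by case aut: (act a (u * t)) => [c|//]; rewrite (str _ _ _ _ _ au aut) in bt.
Qed.

(** Unitarity provides a value at each point; the second half of firmness makes it independent of
    the factorization chosen. *)
Lemma is_delta_exists : firm act -> exists delta, is_delta (act := act) delta.
Proof.
move=> [unit_act firm_act].
have /choice[delta deltaP] (a : A) :
    exists x, forall b t, act b t = Some a -> x = tens act b t.
  have [b [t bt]] := unit_act a.
  by exists (tens act b t) => c s; exact: firm_act.
by exists delta => a b t; exact: deltaP.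
Qed.

Section Delta.
Variable delta : A -> tensor act.
Hypothesis deltaP : is_delta delta.

Lemma is_delta_unique : unitary act -> forall delta', is_delta delta' ->
  delta = delta'.
Proof.
move=> unit_act delta' deltaP'; apply/funext => a.
by have [b [t bt]] := unit_act a; rewrite (deltaP bt) (deltaP' _ _ _ bt).
Qed.

(** If [a = b.t], then [delta a * s] is the tensor of [b] and [ts], which one step takes to that of
    [a] and [s]. *)
Lemma tens_delta : unitary act ->
  forall a s, tens act a s = tensor_act act (delta a) s.
Proof.
move=> unit_act a s; have [b [t bt]] := unit_act a.
by rewrite (deltaP bt) /= tensor_opE (tens_act _ bt).
Qed.

Lemma delta_generated : unitary act -> generated (tensor_act act) delta.
Proof.
move=> unit_act x; have [a [s ->]] := tensor_surj x.
by exists a, s; exact: tens_delta.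
Qed.

Lemma delta_act a b s : unitary act ->
  act a s = Some b -> delta b = tensor_act act (delta a) s.
Proof. by move=> unit_act ab; rewrite -tens_delta//; exact: deltaP. Qed.

(** This converse of [deltaP] yields both injectivity of [delta] and the backward half of (G1). *)
Lemma tens_delta_eq a b s : unitary act -> strong act ->
  tens act a s = delta b -> act a s = Some b.
Proof.
move=> unit_act str; have [c [t ct]] := unit_act b.
by rewrite (deltaP ct) => /(strong_tens_eq str) ->.
Qed.

Lemma delta_globalization : unitary act -> strong act ->
  globalization act (tensor_act act) delta.
Proof.
move=> unit_act str; split.
- move=> a b; have [c [t ct]] := unit_act a.
  (* With [a = c.t], the equality [delta a = delta b] makes [c.t] equal to [b] as well. *)
  by rewrite (deltaP ct) => /(tens_delta_eq unit_act str); rewrite ct => -[].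
- move=> a s; split=> [[b ab] | [b]].
    by exists b; rewrite (delta_act unit_act ab).
  by rewrite -tens_delta// => /(tens_delta_eq unit_act str); exists b.
- by move=> a b s; exact: delta_act.
Qed.

Lemma delta_universal (B : Type) (actB : globalAct S B) (iota : A -> B) :
  unitary act ->
  (forall a b s, act a s = Some b -> iota b = actB (iota a) s) ->
  exists! phi : tensor act -> B,
    gact_morphism (tensor_act act) actB phi /\
    (forall a, iota a = phi (delta a)).
Proof.
move=> unit_act iotaM.
have [|phi phiE] := tensor_lift (f := fun a s => actB (iota a) s).
  (* By (G2), both ends of a step are sent to [iota a * ut]. *)
  by move=> a b u t ab; rewrite (iotaM _ _ _ ab) gactM.
exists phi; split=> [|psi [psiM psi_delta]].
  split=> [x t | a].
    by have [a [s ->]] := tensor_surj x; rewrite /= tensor_opE !phiE gactM.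
  by have [b [t bt]] := unit_act a; rewrite (deltaP bt) phiE; exact: iotaM.
(* Uniqueness: every tensor has the form [delta a * s], so a morphism is determined by its values on
   the image of [delta]. *)
apply/funext => x; have [a [s ->]] := tensor_surj x.
by rewrite phiE tens_delta// psiM psi_delta.
Qed.

End Delta.
End Tensor.

Theorem theorem3p5 (S : semigroupType) (A : Type) (act : partialAct S A)
    (act_firm : firm act) (act_strong : strong act) :
  (exists! delta : A -> tensor act, is_delta delta) /\
  (forall delta : A -> tensor act, is_delta delta ->
    (globalization act (tensor_act act) delta /\
     generated (tensor_act act) delta) /\
    (forall (B : Type) (actB : globalAct S B) (iota : A -> B),
      globalization act actB iota ->
      exists! phi : tensor act -> B,
        gact_morphism (tensor_act act) actB phi /\
        (forall a : A, iota a = phi (delta a)))).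
Proof.
have [unit_act _] := act_firm; split.
  have [delta deltaP] := is_delta_exists act_firm.
  by exists delta; split=> // delta'; exact: is_delta_unique.
move=> delta deltaP; split; first split.
- exact: delta_globalization.
- exact: delta_generated.
- by move=> B actB iota [_ _ iotaM]; exact: delta_universal.
Qed.
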